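(* Let $A$ be a subtracted centrally image partition regular matrix and let $B$ be a Milliken-Taylor matrix. Then the block diagonal matrix $\begin{pmatrix} A & 0 \\ 0 & B\end{pmatrix}$ is image partition regular.
   Context: $\mathbb N=\{1,2,3,\dots\}$ and $\omega=\{0,1,2,\dots\}$. Image partition regular: a finite or infinite matrix $M$ with rational entries (each row having only finitely many nonzero entries) is image partition regular if, whenever $\mathbb N=\bigcup_{i=1}^r E_i$ is a finite coloring of $\mathbb N$, there exist $i$ and a vector $\vec x$ with entries from $\mathbb N$ such that all entries of $M\vec x$ lie in $E_i$. A finite image partition regular matrix is one with finitely many rows and finitely many columns. Central sets: $(\beta\mathbb N,+)$ is the Stone-Čech compactification of the discrete semigroup $(\mathbb N,+)$, whose points are the ultrafilters on $\mathbb N$, with $U\in p+q$ iff $\{x\in\mathbb N: -x+U\in q\}\in p$, where $-x+U=\{y\in\mathbb N: x+y\in U\}$. $K(\beta\mathbb N,+)$ is its smallest two-sided ideal. A set $C\subseteq\mathbb N$ is central in $(\mathbb N,+)$ if $C\in p$ for some idempotent $p\in K(\beta\mathbb N,+)$. Centrally image partition regular: an $\omega\times\omega$ matrix $D$ with entries from $\mathbb Q$ is centrally image partition regular if for every central subset $C$ of $(\mathbb N,+)$ there exists $\vec x\in\mathbb N^\omega$ such that $D\vec x\in C^\omega$. Subtracted centrally image partition regular: an $\omega\times\omega$ matrix $A=(a_{ij})$ with rational entries is subtracted centrally image partition regular if (1) no row of $A$ is $\vec 0$; (2) for each $i\in\omega$, $\{j\in\omega: a_{ij}\neq 0\}$ is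 finite; (3) if $\vec c_0,\vec c_1,\vec c_2,\dots$ are the columns of $A$, there exist $n\in\omega$ and $k\in\mathbb N$ such that the rows of the matrix $(\vec c_n\ \vec c_{n+1}\ \cdots\ \vec c_{n+k-1})$ are precisely the rows of a finite image partition regular matrix (i.e. the set of its rows equals the set of rows of such a finite matrix), and the remaining columns of $A$ form a centrally image partition regular matrix. Milliken-Taylor matrix: for a finite or infinite sequence $\vec x$ with entries from $\omega$, let $d(\vec x)$ be the sequence obtained by deleting all occurrences of $0$ from $\vec x$, and let $c(\vec x)$ be the sequence obtained from $d(\vec x)$ by deleting every entry that is equal to its predecessor. $\vec x$ is compressed if $\vec x=c(\vec x)$. An $\omega\times\omega$ matrix $M$ with entries from $\omega$ is a Milliken-Taylor matrix if each row of $M$ has only finitely many nonzero entries and there exist $m\in\mathbb N$ and a finite compressed sequence $\vec a\in\omega^m$ such that the rows of $M$ are precisely all the vectors $\vec r\in\omega^\omega$ (with finitely many nonzero entries) for which $c(\vec r)=\vec a$. *)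

(* Defs.v *)
From HB Require Import structures.
From mathcomp Require Import all_boot all_order all_algebra.
From mathcomp Require Import boolp classical_sets functions cardinality fsbigop.
From mathcomp Require Import filter.

Set Implicit Arguments.
Unset Strict Implicit.
Unset Printing Implicit Defensive.

Import GRing.Theory.

Local Open Scope classical_set_scope.
Local Open Scope ring_scope.

Record posnat := PosNat { posnat_val :> nat; _ : (0 < posnat_val)%N }.

HB.instance Definition _ := [isSub for posnat_val].
HB.instance Definition _ := [Countable of posnat by <:].

Lemma addp_subproof (m n : posnat) : (0 < m + n)%N.
Proof. by case: m => m m_gt0; rewrite addn_gt0 m_gt0. Qed.

Definition addp (m n : posnat) : posnat := PosNat (addp_subproof m n).

Lemma addpC : commutative addp.
Proof. by move=> m n; apply: val_inj; rewrite /= addnC. Qed.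

Lemma addpA : associative addp.
Proof. by move=> m n k; apply: val_inj; rewrite /= addnA. Qed.

HB.instance Definition _ := GRing.isAddSemigroup.Build posnat addpC addpA.

(* The Stone-Cech compactification of a discrete commutative semigroup [T],
   carried by the ultrafilters on [T]. *)
Definition beta (T : addSemigroupType) : set (set_system T) :=
  [set p | UltraFilter p].

(* [fun y => U (x + y)] is the translate -x + U, also when [T] has no
   opposites. *)
Definition beta_add (T : addSemigroupType) (p q : set_system T) :
    set_system T :=
  [set U | p [set x | q [set y | U (x + y)]]].

Definition beta_ideal (T : addSemigroupType) (I : set (set_system T)) : Prop :=
  [/\ I !=set0, I `<=` @beta T &
      forall p q, I p -> beta q -> I (beta_add p q) /\ I (beta_add q p)].

Definition beta_K (T : addSemigroupType) : set (set_system T) :=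
  smallest (@beta_ideal T) set0.

Definition central (T : addSemigroupType) (C : set T) : Prop :=
  exists p : set_system T,
    [/\ beta p, beta_K p, beta_add p p = p & p C].

(* A matrix with rows indexed by [I] and columns by [J] is a function
   [I -> J -> rat]; [I] and [J] may be infinite. *)
Definition row_finite (R : nmodType) (I J : Type) (M : I -> J -> R) : Prop :=
  forall i, finite_set [set j | M i j != 0].

(* The sum is over the support of the summand, and is 0 by convention when
   that support is infinite. *)
Definition mx_apply (I : Type) (J : choiceType) (M : I -> J -> rat)
    (x : J -> posnat) (i : I) : rat :=
  \sum_(j \in [set: J]) M i j * (x j)%:R.

(* All entries of [M x] lie in the set [C] of positive integers, seen as a
   set of rationals. *)
Definition image_in (I : Type) (J : choiceType) (M : I -> J -> rat)
    (x : J -> posnat) (C : set posnat) : Prop :=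
  forall i, [set (n : nat)%:R | n in C] (mx_apply M x i).

Definition image_partition_regular (I : Type) (J : choiceType)
    (M : I -> J -> rat) : Prop :=
  row_finite M /\
  forall (r : nat) (E : 'I_r -> set posnat),
    [set: posnat] = \bigcup_i E i ->
    exists (i : 'I_r) (x : J -> posnat), image_in M x (E i).

Definition centrally_image_partition_regular (D : nat -> nat -> rat) : Prop :=
  forall C : set posnat, central C -> exists x : nat -> posnat, image_in D x C.

Definition columns_block (A : nat -> nat -> rat) (n k : nat) :
    nat -> 'I_k -> rat :=
  fun i j => A i (n + j)%N.

Definition drop_columns (A : nat -> nat -> rat) (n k : nat) :
    nat -> nat -> rat :=
  fun i j => A i (if (j < n)%N then j else (j + k)%N).

Definition subtracted_centrally_image_partition_regular
    (A : nat -> nat -> rat) : Prop :=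
  [/\ forall i, exists j, A i j != 0,
      row_finite A &
      exists n k : nat,
        [/\ (0 < k)%N,
            exists (m : nat) (F : 'M[rat]_(m, k)),
              image_partition_regular (fun i j => F i j) /\
              range (columns_block A n (k := k)) = range (fun i j => F i j) &
            centrally_image_partition_regular (drop_columns A n k)]].

Definition delete0 (s : seq nat) : seq nat := [seq u <- s | u != 0%N].

Definition compress (s : seq nat) : seq nat :=
  if delete0 s is u :: t then u :: mask (pairmap (fun v w => w != v) u t) t
  else [::].

(* c(r) = a for an infinite sequence r with finitely many nonzero entries:
   the zero tail of r is deleted anyway, so c(r) is computed on a finite
   prefix beyond which r vanishes; the choice of the prefix is immaterial. *)
Definition has_compression (r : nat -> nat) (a : seq nat) : Prop :=
  exists2 N, (forall j, (N <= j)%N -> r j = 0%N) & compress (mkseq r N) = a.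

Definition milliken_taylor (M : nat -> nat -> nat) : Prop :=
  row_finite M /\
  exists a : seq nat,
    [/\ (0 < size a)%N, compress a = a &
        range M = [set r | has_compression r a]].

Definition block_diag (I1 I2 J1 J2 : Type) (A : I1 -> J1 -> rat)
    (B : I2 -> J2 -> rat) (i : I1 + I2) (j : J1 + J2) : rat :=
  match i, j with
  | inl i, inl j => A i j
  | inr i, inr j => B i j
  | _, _ => 0
  end.

(* Main.v *)
Require Import Defs.
From HB Require Import structures.
From mathcomp Require Import all_boot all_order all_algebra.
From mathcomp Require Import boolp classical_sets cardinality fsbigop.
From mathcomp Require Import filter.
From mathcomp Require Import zify ring.

Set Implicit Arguments.
Unset Strict Implicit.
Unset Printing Implicit Defensive.

Import Order.TTheory GRing.Theory Num.Theory.

Local Open Scope classical_set_scope.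
Local Open Scope ring_scope.

(* Fix an idempotent p in a minimal left ideal of beta N and a colour class E in
   a1 p + ... + ak p, where (a1, ..., ak) is the compressed sequence of B.

   As p is idempotent, E contains a Milliken-Taylor system of type (a1, ..., ak),
   which handles B.

   For A, let M be the finite matrix and D the remaining columns.  Every member
   of p contains an image of M.  Applying this to the successive summands
   a1 p, ..., a(k-1) p (and, if k = 1, splitting p = p + p) and adding up the
   vectors found gives a vector x such that a member of ak p is translated into E
   by all the entries of M x at once; that member, being a dilate of a central
   set, contains an image of D.

   That M has images in central sets is reduced to an analogue of Rado's columns
   condition, obtained by colouring integers by their leading digits, and then
   proved by induction on the levels of that condition, with a van der Waerden
   argument relative to an idempotent on the semigroup of vectors.

   Closed subsets of beta T are handled through the filters they come from, so
   that no topology on beta T is needed. *)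

(** * Idempotents and minimal left ideals of ultrafilters *)

(** Zorn's lemma for filters, applied below to the condition that [G] be contained in [G + G] and to
    translation invariance. *)
Lemma maximal_filter_above (T : Type) (Q : set_system T -> Prop)
    (F : set_system T) :
  ProperFilter F -> Q F ->
  (forall A : set (set_system T), A !=set0 ->
     (forall G, A G -> ProperFilter G /\ Q G) -> total_on A subset ->
     Q (\bigcup_(G in A) G)) ->
  exists G, [/\ F `<=` G, ProperFilter G, Q G &
    forall H, ProperFilter H -> Q H -> G `<=` H -> H = G].
Proof.
move=> FF QF Qchain.
pose good G := [/\ F `<=` G, ProperFilter G & Q G].
(* [Zorn_bigcup] includes the empty chain, whose union is [set0]; this extra element is never
   maximal, as [F] lies above it. *)
have [A AP Atot|G [PG Gmax]] :=
  @Zorn_bigcup (set T) [set G | G = set0 \/ good G].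
  have [[G0 [AG0 goodG0]]|nogood] := pselect (exists G, A G /\ good G);
    last first.
    left; apply/seteqP; split => // U [G AG GU].
    have [G0|gG] := AP _ AG; first by rewrite -G0.
    by case: nogood; exists G.
  pose A' := A `&` good.
  have AA' : \bigcup_(G in A) G = \bigcup_(G in A') G.
    apply/seteqP; split=> U [G AG GU]; last by exists G => //; case: AG.
    by exists G => //; split=> //; have [G_0|//] := AP _ AG; rewrite G_0 in GU.
  right; rewrite AA'.
  have totA' : total_on A' subset.
    by move=> G H [AG _] [AH _]; exact: Atot.
  have goodA' G : A' G -> ProperFilter G /\ Q G by move=> [_ []].
  split.
  - by have [FG0 _ _] := goodG0; move=> U FU; exists G0 => //; exact: FG0.
  - apply: Build_ProperFilter_ex.
      by move=> B [H /goodA' [HF _] HB]; exact: (@filter_ex _ _ HF).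
    split.
    + by exists G0 => //; have [_ PG0 _] := goodG0; exact: filterT.
    + move=> B C [HB AHB HBB] [HC AHC HCC].
      have [HBF _] := goodA' _ AHB; have [HCF _] := goodA' _ AHC.
      have [sub|sub] := totA' _ _ AHB AHC.
        by exists HC => //; apply: filterI => //; exact: sub.
      by exists HB => //; apply: filterI => //; exact: sub.
    + move=> B C BC [H AH HB]; exists H => //; have [HF _] := goodA' _ AH.
      exact: filterS HB.
  - by apply: Qchain => //; exists G0.
have goodG : good G.
  have [G0|//] := PG; exfalso.
  apply: (Gmax F); last by right; split.
  by rewrite G0; split=> // /(_ _ (filterT : F setT)).
have [FG PrG QG] := goodG.
exists G; split=> // H PrH QH GH.
apply/seteqP; split=> //; apply: contrapT => nHG.
by apply: (Gmax H); [split | right; split=> //; exact: subset_trans GH].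
Qed.

Lemma ultra_notC (T : Type) (p : set_system T) (U : set T) :
  UltraFilter p -> ~ p U -> p (~` U).
Proof. by move=> pU nU; have [//|] := in_ultra_setVsetC U pU. Qed.

(** The last clause serves to show that [G] inherits a closure property, mostly in order to invoke
    the maximality of [F]. *)
Lemma filter_add_base (T : Type) (F : set_system T) (I : Type) (D : set I)
    (B : I -> set T) :
  Filter F -> (exists i, D i) ->
  (forall i j, D i -> D j -> exists2 k, D k & B k `<=` B i `&` B j) ->
  (forall A i, F A -> D i -> A `&` B i !=set0) ->
  exists G, [/\ ProperFilter G, F `<=` G, (forall i, D i -> G (B i)) &
    forall U, G U -> exists A i, [/\ F A, D i & A `&` B i `<=` U]].
Proof.
move=> FF [i0 Di0] BI ne.
exists (filter_from [set Ai : set T * I | F Ai.1 /\ D Ai.2]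
   (fun Ai => Ai.1 `&` B Ai.2)); split.
- apply: filter_from_proper; last by move=> [A i] [/= FA Di]; exact: ne.
  apply: filter_from_filter.
    by exists (setT, i0); split=> //; exact: filterT.
  move=> [A i] [A' j] /= [FA Di] [FA' Dj].
  have [k Dk kij] := BI _ _ Di Dj.
  exists (A `&` A', k) => /=; first by split=> //; exact: filterI.
  by move=> x [[Ax A'x] /kij [Bi Bj]].
- by move=> A FA; exists (A, i0) => //= x [].
- by move=> i Di; exists (setT, i) => /=; [split=> //; exact: filterT|move=> x []].
- by move=> U [[A i] [/= FA Di] sub]; exists A, i.
Qed.

Section FilterSum.
Variable T : addSemigroupType.
Implicit Types (F p q : set_system T) (U : set T).

Lemma beta_add_filter F q : ProperFilter F -> ProperFilter q ->
  ProperFilter (beta_add F q).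
Proof.
move=> FF qF; split.
  rewrite /beta_add /= => F0; apply: (filter_not_empty F).
  by apply: filterS F0 => x /= /filter_not_empty.
split.
- by rewrite /beta_add /=; apply: filterE => x; apply: filterE.
- move=> U V; rewrite /beta_add /= => FU FV; apply: filterS2 FU FV => x.
  exact: filterI.
- move=> U V UV; rewrite /beta_add /=; apply: filterS => x /=; apply: filterS.
  by move=> y; exact: UV.
Qed.

Lemma beta_add_ultra p q : UltraFilter p -> UltraFilter q ->
  UltraFilter (beta_add p q).
Proof.
move=> pU qU; have PF : ProperFilter (beta_add p q) by exact: beta_add_filter.
split=> // G PG sub; apply/seteqP; split=> // U GU; apply: contrapT => nU.
apply: (filter_not_empty G); rewrite -(setICr U); apply: filterI => //.
apply: sub; rewrite /beta_add /=.
apply: filterS (ultra_notC pU nU) => x /= nx; exact: (ultra_notC qU nx).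
Qed.

(* Such filters stand for the closed subsemigroups in Ellis' theorem; a maximal
   one is an ultrafilter (Papazyan). *)
Lemma idempotent_above F : ProperFilter F -> F `<=` beta_add F F ->
  exists p, [/\ UltraFilter p, F `<=` p & beta_add p p = p].
Proof.
move=> PF FF.
have [|G [FG PG GG Gmax]] :=
  @maximal_filter_above T (fun G => G `<=` beta_add G G) F PF FF.
  move=> A _ good _ U [H AH HU]; exists H => //.
  have [PH HH] := good _ AH; have := HH _ HU; rewrite /beta_add /=.
  by apply: filterS => x /= Hx; exists H.
have [p [pU Gp]] := ultraFilterLemma PG.
exists p; split=> //; first exact: subset_trans Gp.
have GGp : beta_add G p = G.
  apply: Gmax; first exact: beta_add_filter.
    move=> U GW; have GW' := GG _ (GG _ GW); rewrite /beta_add /= in GW' *.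
    apply: filterS GW' => x /= /Gp; apply: filterS => y /=.
    by apply: filterS => z /=; apply: filterS => w /=; rewrite -Algebra.addrA.
  by move=> U /GG; rewrite /beta_add /=; apply: filterS => x /=; exact: Gp.
have ne A U : G A -> p U -> A `&` [set x | p [set y | U (x + y)]] !=set0.
  move=> GA pU'; apply: contrapT => /set0P/negP/negPn/eqP A0.
  apply: (filter_not_empty p); rewrite -(setICr U); apply: filterI => //.
  apply: Gp; rewrite -GGp /beta_add /=; apply: filterS GA => x Ax.
  apply: (ultra_notC pU) => pxU.
  by have : set0 x by rewrite -A0.
(* [H] describes the [q] above [G] with [q + p = p]. They exist because [G + p = G]; maximality
   gives [H = G], so [p] is one of them. *)
have [H [PH GH Hp HU]] : exists H, [/\ ProperFilter H, G `<=` H,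
    (forall U, p U -> H [set x | p [set y | U (x + y)]]) &
    forall V, H V -> exists A U, [/\ G A, p U &
      A `&` [set x | p [set y | U (x + y)]] `<=` V]].
  apply: (@filter_add_base _ G _ p) => //; first by exists setT; exact: filterT.
  move=> U V pU' pV; exists (U `&` V); first exact: filterI.
  by move=> x /= pUV; split; apply: filterS pUV => y [].
have HG : H = G.
  apply: Gmax => // V /HU [A [U [GA pU' sub]]].
  rewrite /beta_add /=.
  apply: filterS2 (GH _ (GG _ GA)) (Hp _ pU') => x /= GxA pxU.
  apply: filterS2 (GH _ GxA) (Hp _ pxU) => y /= Axy pxyU.
  by apply: sub; split=> //=; apply: filterS pxyU => z /=; rewrite Algebra.addrA.
apply: max_filter; first exact: beta_add_filter.
by move=> U /Hp; rewrite HG => /Gp.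
Qed.

End FilterSum.

Lemma trivial_filter_proper (T : Type) (x0 : T) :
  ProperFilter [set setT : set T].
Proof.
split; first by move=> /seteqP[_ /(_ x0)]; apply.
split=> // [U V -> ->|U V UV UT]; first by rewrite /= setIT.
by apply/seteqP; split=> // x _; apply: UV; rewrite UT.
Qed.

Section MinimalLeftIdeal.
Variable T : addSemigroupType.
Implicit Types (F p q r : set_system T) (U C : set T).

Definition translation_invariant F :=
  forall U, F U -> forall x, F [set y | U (x + y)].

(* The ultrafilters finer than [F] form a minimal left ideal of [beta T]. *)
Definition maximal_invariant F :=
  [/\ ProperFilter F, translation_invariant F &
    forall G, ProperFilter G -> translation_invariant G -> F `<=` G -> G = F].

Definition finer F p := UltraFilter p /\ F `<=` p.

Lemma maximal_invariant_exists (x0 : T) : exists F, maximal_invariant F.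
Proof.
have PT := trivial_filter_proper x0.
have [||F [_ PF IF Fmax]] := @maximal_filter_above T translation_invariant _ PT.
- by move=> U -> x.
- move=> A _ good _ U [G AG GU] x; exists G => //.
  by have [_ IG] := good _ AG; exact: IG.
by exists F.
Qed.

Variable F : set_system T.
Hypothesis Fmax : maximal_invariant F.

#[local] Instance maximal_invariant_proper : ProperFilter F.
Proof. by case: Fmax. Qed.
Let IF : translation_invariant F. Proof. by case: Fmax. Qed.

Lemma finer_idempotent : exists p, finer F p /\ beta_add p p = p.
Proof.
have [|p [pU Fp pp]] := idempotent_above maximal_invariant_proper.
  by move=> U FU; rewrite /beta_add /=; apply: filterE => x; exact: IF.
by exists p.
Qed.

Lemma finer_add r q : UltraFilter r -> finer F q -> finer F (beta_add r q).
Proof.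
move=> rU [qU Fq]; split; first exact: beta_add_ultra.
by move=> U FU; rewrite /beta_add /=; apply: filterE => x; apply: Fq; exact: IF.
Qed.

(** Minimality of the left ideal. [F + q] is invariant and finer than [F], hence equal to [F]; so
    for [U] in [p], the set of [x] with [-x + U] in [q] meets every member of [F]. *)
Lemma finer_divl p q : finer F p -> finer F q ->
  exists2 r, finer F r & beta_add r q = p.
Proof.
move=> [pU Fp] [qU Fq].
have FqF : beta_add F q = F.
  case: Fmax => _ _; apply; first exact: beta_add_filter.
    move=> U; rewrite /beta_add /= => FW y.
    apply: filterS (IF FW y) => x /=; apply: filterS => z /=.
    by rewrite Algebra.addrA.
  by move=> U FU; rewrite /beta_add /=; apply: filterE => x; apply: Fq; exact: IF.
have [G [PG FG GB _]] : exists G, [/\ ProperFilter G, F `<=` G,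
    (forall U, p U -> G [set x | q [set y | U (x + y)]]) &
    forall V, G V -> exists A U, [/\ F A, p U &
      A `&` [set x | q [set y | U (x + y)]] `<=` V]].
  apply: (@filter_add_base _ F _ p).
  - by exists setT; exact: filterT.
  - move=> U V pU' pV; exists (U `&` V); first exact: filterI.
    by move=> x /= pUV; split; apply: filterS pUV => y [].
  - move=> A U FA pU'; apply: contrapT => /set0P/negP/negPn/eqP A0.
    apply: (filter_not_empty p); rewrite -(setICr U); apply: filterI => //.
    apply: Fp; rewrite -FqF /beta_add /=; apply: filterS FA => x Ax.
    apply: (ultra_notC qU) => qxU.
    by have : set0 x by rewrite -A0.
have [r [rU Gr]] := ultraFilterLemma PG.
exists r; first by split=> //; exact: subset_trans Gr.
apply: max_filter; first exact: beta_add_filter.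
by move=> U /GB /Gr.
Qed.

(** Otherwise the complements of all finite unions of translates of [C] could be added to [F]
    keeping it invariant, so they would lie in [F] by maximality. But [p = r + p] for some [r],
    which puts a translate of [C] in [p]. *)
Lemma finer_syndetic p C : finer F p -> p C ->
  exists ys : seq T, F [set n | exists2 y, y \in ys & C (y + n)].
Proof.
move=> Lp pC; have [pU Fp] := Lp; apply: contrapT => nosyn.
pose B (ys : seq T) := [set n | forall y, y \in ys -> ~ C (y + n)].
have [G [PG FG GB GU]] : exists G, [/\ ProperFilter G, F `<=` G,
    (forall ys, setT ys -> G (B ys)) &
    forall V, G V -> exists A ys, [/\ F A, setT ys & A `&` B ys `<=` V]].
  apply: (@filter_add_base _ F _ setT).
  - by exists [::].
  - move=> ys zs _ _; exists (ys ++ zs) => // n Bn.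
    by split=> y yin; apply: Bn; rewrite mem_cat yin ?orbT.
  - move=> A ys FA _; apply: contrapT => /set0P/negP/negPn/eqP A0.
    apply: nosyn; exists ys; apply: filterS FA => n An /=.
    apply: contrapT => nC; suff : set0 n by [].
    rewrite -A0; split=> // y yin Cy; apply: nC; by exists y.
have IG : translation_invariant G.
  move=> V /GU [A [ys [FA _ sub]]] x.
  apply: filterS2 (FG _ (IF FA x)) (GB [seq y + x | y <- ys] I) => n /= An Bn.
  apply: sub; split=> // y yin; rewrite Algebra.addrA; apply: Bn.
  exact: map_f.
have GF : G = F by case: Fmax => _ _; apply.
have [r [rU Fr] rp] := finer_divl Lp Lp.
move: pC; rewrite -rp /beta_add /= => rC.
have [y pyC] := filter_ex rC.
have := GB [:: y] I; rewrite GF => /Fp pB.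
apply: (filter_not_empty p); apply: filterS2 pyC pB => n /= Cn.
by move=> /(_ y); apply; rewrite ?mem_head.
Qed.

(** An ideal containing [q] contains [q + p], hence also [p], which is [r + (q + p)] for some
    [r]. *)
Lemma finer_beta_K p : finer F p -> beta_K p.
Proof.
move=> Lp I [[[q Iq] Ibeta Iideal] _].
have [pU _] := Lp; have qU : UltraFilter q := Ibeta _ Iq.
have [_ Iqp] := Iideal q p Iq pU.
have [Iqp' _] := Iideal q p Iq pU.
have [r [rU _] <-] := finer_divl Lp (finer_add qU Lp).
by have [_] := Iideal _ r Iqp' rU.
Qed.

End MinimalLeftIdeal.

(** * Central sets and shifted homomorphisms *)

Lemma filter_forall_seq (T : Type) (I : eqType) (F : set_system T) (s : seq I)
    (P : I -> set T) : Filter F ->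
  (forall i, i \in s -> F (P i)) -> F [set x | forall i, i \in s -> P i x].
Proof.
move=> FF; elim: s => [|i s IHs] sP; first exact: filterE.
have Fs : F [set x | forall j, j \in s -> P j x].
  by apply: IHs => j js; apply: sP; rewrite inE js orbT.
apply: filterS2 (sP i (mem_head _ _)) Fs => x Pix Psx j.
by rewrite inE => /orP[/eqP->|]; [|exact: Psx].
Qed.

Lemma ultra_exists_seq (T : Type) (I : eqType) (p : set_system T) (s : seq I)
    (P : I -> set T) : UltraFilter p ->
  p [set x | exists2 i, i \in s & P i x] -> exists2 i, i \in s & p (P i).
Proof.
move=> pU psP; apply: contrapT => nP.
have pC : p [set x | forall i, i \in s -> (~` P i) x].
  apply: filter_forall_seq => i si; apply: (ultra_notC pU) => pPi.
  by apply: nP; exists i.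
apply: (filter_not_empty p); apply: filterS2 psP pC => x [i si Pix] /(_ i si).
exact.
Qed.

Definition posnat_int (n : posnat) : int := (n : nat)%:Z.

Lemma posnat_intD (m n : posnat) :
  posnat_int (m + n) = posnat_int m + posnat_int n.
Proof. exact: PoszD. Qed.

Lemma posnat_int_exceeds (m n : posnat) (z : int) :
  (`|z| < n)%N -> 0 < posnat_int m + posnat_int n - z.
Proof. by case: m n => m m0 [n n0]; rewrite /posnat_int /=; lia. Qed.

Lemma posnat_of_int (z : int) : 0 < z -> exists n, posnat_int n = z.
Proof. by case: z => // n n_gt0; exists (PosNat n_gt0). Qed.

(** [p] has the form [r + (b + p)] with [b] principal at [N + 1]. *)
Lemma finer_gt (F p : set_system posnat) (N : nat) :
  maximal_invariant F -> finer F p -> p [set n : posnat | (N < n)%N].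
Proof.
move=> Fmax Lp; pose b := @PosNat N.+1 isT.
have Lq := finer_add Fmax (principal_filter_ultra b) Lp.
have [r [rU _] <-] := finer_divl Fmax Lp Lq.
rewrite /beta_add /=; apply: filterE => x; apply/principal_filterP => /=.
have [pU _] := Lp; apply: filterE => y /=.
by case: x y => x ? [y ?] /=; rewrite addSn addnS ltnS addnCA leq_addr.
Qed.

Section Star.
Variables (S : addSemigroupType) (e : set_system S).
Hypotheses (eU : UltraFilter e) (ee : beta_add e e = e).

(** By [star_shift], almost every translate of an element of the star stays in the star, so sums can
    be built one term at a time. *)
Definition star (U : set S) := [set s | U s /\ e [set t | U (s + t)]].

Lemma star_in U : e U -> e (star U).
Proof.
move=> eUU; apply: filterI => //.
by move: eUU; rewrite -{1}ee.
Qed.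

Lemma star_shift U s : star U s -> e [set t | star U (s + t)].
Proof.
move=> [_ eUs]; apply: filterS (star_in eUs) => t [/= Ust eUst]; split=> //.
by apply: filterS eUst => v /=; rewrite Algebra.addrA.
Qed.

End Star.

(** For [f i s = i * s] on the positive integers this is van der Waerden's theorem inside [C], with
    difference in [U]. The induction on [l] passes to the differences with [f ord0]. *)
Lemma central_shift (F : set_system posnat) (S : addSemigroupType)
    (e : set_system S) (l : nat) (f : 'I_l -> S -> int) :
    maximal_invariant F -> UltraFilter e -> beta_add e e = e ->
    (forall i s t, f i (s + t) = f i s + f i t) ->
  forall p C U, finer F p -> p C -> e U ->
  exists (a : posnat) (s : S), U s /\
    forall i, (posnat_int @` C) (posnat_int a + f i s).
Proof.
move=> Fmax eU ee; elim: l f => [|l IHl] f fD p C U Lp pC eUU.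
  have [pU _] := Lp.
  have [a _] := filter_ex pC; have [s Us] := filter_ex eUU.
  by exists a, s; split=> // -[].
pose g i s := f (lift ord0 i) s - f ord0 s.
have gD i s t : g i (s + t) = g i s + g i t.
  by rewrite /g !fD opprD addrACA.
have [ys Fys] := finer_syndetic Fmax Lp pC.
have [s0 _] := filter_ex eUU.
pose goal := exists (a : posnat) (s : S), U s /\
  forall i, (posnat_int @` C) (posnat_int a + f i s).
(* Colour focusing: the colour of [n] is a [y] in [ys] with [C (y + n)], and a
   new colour is focused as long as the goal is not reached. *)
suff /(_ (size ys).+1)[//|[q [D [Y [sig [[_ _ Yuniq Ysize] [Yys _ _]]]]]]] :
    forall k, goal \/ exists q D (Y : seq posnat) (sig : posnat -> S),
      [/\ finer F q, q D, uniq Y & size Y = k] /\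
      [/\ {subset Y <= ys}, forall y, y \in Y -> star e U (sig y) &
        forall y x i, y \in Y -> D x ->
          (posnat_int @` C) (posnat_int y + posnat_int x + g i (sig y))].
  by have := uniq_leq_size Yuniq Yys; rewrite Ysize ltnn.
elim=> [|k [|[q [D [Y [sig [[Lq qD Yuniq Ysize] [Yys YU YC]]]]]]]]; [|by left|].
  right; exists p, setT, [::], (fun=> s0); split; split=> //.
  by have [pU _] := Lp; exact: filterT.
have [qU Fq] := Lq.
have [y0 y0ys qy0] := ultra_exists_seq qU (Fq _ Fys).
(* If a colour recurs, [y0 + x] and all [y0 + x + g i (sig y0)] lie in [C]. Subtracting
   [f ord0 (sig y0)] from [y0 + x] gives [a], positive because [x] is large. *)
have [y0Y|y0Y] := boolP (y0 \in Y).
  left.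
  have big : q [set x : posnat | (`|f ord0 (sig y0)|%N < x)%N].
    exact: finer_gt Lq.
  have [x [[Dx Cx] /= xbig]] := filter_ex (filterI (filterI qD qy0) big).
  have [|a aE] := @posnat_of_int (posnat_int y0 + posnat_int x - f ord0 (sig y0)).
    exact: posnat_int_exceeds.
  exists a, (sig y0); split; first by have [] := YU _ y0Y.
  move=> i; have [j ->|->] := unliftP ord0 i.
    by have := YC _ _ j y0Y Dx; rewrite /g aE -[_ - _ + _]addrA [- _ + _]addrC.
  by exists (y0 + x) => //; rewrite posnat_intD aE subrK.
right.
pose D' := D `&` [set x | C (y0 + x)].
have qD' : q D' by exact: filterI.
(* As [q = r + q], the induction hypothesis for [r] yields [a] and [s] such that the next
   ultrafilter can be [a + q]. Old colours move from [sig y] to [sig y + s]; the new one starts at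
   [s]. *)
have [r Lr rq] := finer_divl Fmax Lq Lq.
have rD' : r [set x | q [set y | D' (x + y)]] by rewrite -rq in qD'.
have eU' : e (star e U `&` [set t | forall y, y \in Y -> star e U (sig y + t)]).
  apply: filterI; first exact: star_in.
  by apply: filter_forall_seq => y yY; exact: star_shift (YU _ yY).
have [a [s [[Us UsY] aD]]] := IHl _ gD _ _ _ Lr rD' eU'.
exists (beta_add (principal_filter a) q).
exists [set x | forall i, (posnat_int @` D') (posnat_int x + g i s)].
exists (y0 :: Y), (fun y => if y == y0 then s else sig y + s).
split; split.
- exact: finer_add (principal_filter_ultra a) Lq.
- rewrite /beta_add /=; apply/principal_filterP => /=.
  apply: filter_forall => i; have [n qn nE] := aD i.
  apply: filterS qn => y /= D'y; exists (n + y) => //.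
  by rewrite !posnat_intD nE addrAC.
- by rewrite /= y0Y.
- by rewrite /= Ysize.
- by move=> y; rewrite inE => /orP[/eqP->|/Yys].
- move=> y; rewrite inE; case: eqP => [_ _|_ /= yY]; first exact: Us.
  exact: UsY.
- move=> y x i; rewrite inE; case: eqP => [-> _|_ /= yY] /(_ i)[n [Dn Cn] nE].
    by exists (y0 + n) => //; rewrite posnat_intD nE addrA.
  have [m Cm mE] := YC _ _ i yY Dn; exists m => //.
  by rewrite mE nE gD [g i (sig y) + _]addrC !addrA.
Qed.

(** The residue of [h] modulo [c] is constant on a member of [e]; idempotence gives [r + r = r] for
    this residue, so it is zero. *)
Lemma idempotent_dvdz (S : addSemigroupType) (e : set_system S)
    (h : S -> int) (c : nat) :
  UltraFilter e -> beta_add e e = e -> (forall s t, h (s + t) = h s + h t) ->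
  (0 < c)%N -> e [set s | (c%:Z %| h s)%Z].
Proof.
move=> eU ee hD c_gt0; have cN0 : c%:Z != 0 by case: c c_gt0.
have [|r _ er] := @ultra_exists_seq S nat e (iota 0 c)
    (fun r => [set s | h s = r%:Z %[mod c%:Z]]%Z) eU.
  apply: filterE => s /=; exists (`|(h s %% c%:Z)%Z|%N).
    rewrite mem_iota /= add0n -ltz_nat gez0_abs ?modz_ge0//.
    by have := ltz_pmod (h s) (c_gt0 : 0 < c%:Z).
  by rewrite gez0_abs ?modz_ge0 ?modz_mod.
have := er; rewrite -{1}ee /beta_add /= => er2.
have [s [/= sr /(filterI er) /filter_ex [t /= [tr str]]]] :=
  filter_ex (filterI er er2).
have r0 : (c%:Z %| r%:Z)%Z.
  move: str; rewrite hD -modzDm sr tr modzDm => /eqP.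
  by rewrite eqz_mod_dvd addrK.
apply: filterS er => u /= ur.
by apply/dvdz_mod0P; rewrite ur; apply/dvdz_mod0P.
Qed.

Definition lin (m k : nat) (G : 'I_m -> 'I_k -> int) (i : 'I_m)
  (x : {ffun 'I_k -> posnat}) : int := \sum_j G i j * posnat_int (x j).

Lemma linD m k (G : 'I_m -> 'I_k -> int) i x y :
  lin G i (x + y) = lin G i x + lin G i y.
Proof.
rewrite /lin -big_split; apply: eq_bigr => j _ /=.
by rewrite ffunE posnat_intD mulrDr.
Qed.

Lemma ffun_posnat_add k (x : {ffun 'I_k -> posnat}) (y : 'I_k -> nat) :
  exists z : {ffun 'I_k -> posnat},
    forall j, posnat_int (z j) = posnat_int (x j) + (y j)%:Z.
Proof.
have xy_gt0 j : (0 < x j + y j)%N.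
  by case: (x j) => n n_gt0; rewrite addn_gt0 n_gt0.
by exists [ffun j => PosNat (xy_gt0 j)] => j; rewrite ffunE.
Qed.

(* An idempotent with all marginals equal to [p] is built one level at a time:
   a solution for the lower levels is translated by a multiple of [y]. *)
Lemma central_image_idempotent (F p : set_system posnat) (m k : nat)
    (G : 'I_m -> 'I_k -> int) (lev : 'I_m -> nat) (c : nat) :
    maximal_invariant F -> finer F p -> beta_add p p = p -> (0 < c)%N ->
    (forall i0, exists y : 'I_k -> nat, forall i,
       (lev i = lev i0 -> \sum_j G i j * (y j)%:Z = c%:Z) /\
       ((lev i < lev i0)%N -> \sum_j G i j * (y j)%:Z = 0)) ->
  exists e : set_system {ffun 'I_k -> posnat},
    [/\ UltraFilter e, beta_add e e = e & forall i C, p C ->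
      e [set x | (posnat_int @` C) (lin G i x)]].
Proof.
move=> Fmax Lp pp c_gt0 Hy; have [pU _] := Lp.
suff levels s : exists e : set_system {ffun 'I_k -> posnat},
    [/\ UltraFilter e, beta_add e e = e & forall i C, (lev i < s)%N -> p C ->
      e [set x | (posnat_int @` C) (lin G i x)]].
  have [e [eU ee eC]] := levels (\max_i lev i).+1.
  by exists e; split=> // i C; apply: eC; rewrite ltnS leq_bigmax.
elim: s => [|s [e [eU ee eC]]].
  have PT :=
    trivial_filter_proper ([ffun=> @PosNat 1 isT] : {ffun 'I_k -> posnat}).
  have [|e [eU _ ee]] := idempotent_above PT; last by exists e.
  by move=> U ->; apply: (@filterE _ _ PT) => x; apply: (@filterE _ _ PT).
have [[i0 i0s]|nos] := pselect (exists i0, lev i0 = s); last first.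
  exists e; split=> // i C; rewrite ltnS leq_eqVlt => /orP[/eqP is_|].
    by case: nos; exists i.
  exact: eC.
have [y Hy0] := Hy i0; rewrite i0s in Hy0.
pose V C := [set x : {ffun 'I_k -> posnat} |
  forall i, (lev i <= s)%N -> (posnat_int @` C) (lin G i x)].
have VI C C' : V (C `&` C') `<=` V C `&` V C'.
  by move=> x Vx; split=> i /Vx [n [Cn C'n] <-]; exists n.
(* Lower rows are served by [e]. On level [s], [central_shift] gives images up to a common shift
   [a], a multiple [b * c] since only multiples of [c] are kept. Adding [b * y] to [x] realizes this
   shift and leaves the lower rows unchanged. *)
have Vne C : p C -> V C !=set0.
  move=> pC.
  have pCc : p (C `&` [set n | (c%:Z %| posnat_int n)%Z]).
    by apply: filterI => //; apply: idempotent_dvdz => //; exact: posnat_intD.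
  have eUU : e [set x | forall i,
      ((lev i < s)%N -> (posnat_int @` C) (lin G i x)) /\
      (c%:Z %| lin G i x)%Z].
    apply: filter_forall => i; apply: filterI.
      have [lt_is|] := boolP (lev i < s)%N; last by move=> _; exact: filterE.
      by apply: filterS (eC i C lt_is pC) => x.
    by apply: idempotent_dvdz => //; exact: linD.
  pose R := [pred i | lev i == s].
  have [a [x [xU xC]]] := central_shift
    (f := fun j : 'I_#|R| => lin G (enum_val j))
    Fmax eU ee (fun j x y => linD G _ x y) Lp pCc eUU.
  have xR i : lev i = s -> exists2 n, (C n /\ (c%:Z %| posnat_int n)%Z) &
      posnat_int n = posnat_int a + lin G i x.
    move=> is_; have iR : i \in R by rewrite inE is_.
    have [n Cn nE] := xC (enum_rank_in iR i).
    by exists n; rewrite // nE enum_rankK_in.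
  have [b ab] : exists b : nat, posnat_int a = (b * c)%N%:Z.
    have [n [_ cn] nE] := xR _ i0s.
    have : (c%:Z %| posnat_int a)%Z.
      by rewrite -(rpredDr _ (proj2 (xU i0))) -nE.
    by move=> /dvdnP[b bE]; exists b; rewrite -bE.
  have [z zE] := ffun_posnat_add x (fun j => b * y j)%N.
  exists z => i.
  have -> : lin G i z = lin G i x + b%:Z * \sum_j G i j * (y j)%:Z.
    rewrite /lin mulr_sumr -big_split; apply: eq_bigr => j _ /=.
    by rewrite zE PoszM mulrDr mulrCA.
  have [Hs Hlt] := Hy0 i.
  rewrite leq_eqVlt => /orP[/eqP is_|is_].
    have [n [Cn _] nE] := xR _ is_; exists n => //.
    by rewrite Hs// -PoszM -ab nE addrC.
  by rewrite Hlt// mulr0 addr0; exact: (proj1 (xU i)).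
have [G' [PG' _ G'V G'U]] : exists G', [/\ ProperFilter G',
    [set setT] `<=` G', (forall C, p C -> G' (V C)) &
    forall U, G' U -> exists A C, [/\ [set setT] A, p C & A `&` V C `<=` U]].
  have PT :=
    trivial_filter_proper ([ffun=> @PosNat 1 isT] : {ffun 'I_k -> posnat}).
  apply: (@filter_add_base _ _ _ p) => //.
  - by exists setT; exact: filterT.
  - by move=> C C' pC pC'; exists (C `&` C'); [exact: filterI|exact: VI].
  - by move=> _ C -> pC; rewrite setTI; exact: Vne.
(* The filter of the [V C] is contained in its sum with itself because [p = p + p] and [lin G i] is
   additive. *)
have [|e' [e'U G'e' e'e']] := idempotent_above PG'.
  move=> U /G'U [A [C [-> pC]]]; rewrite setTI => VU.
  have := pC; rewrite -{1}pp => /G'V; apply: filterS => x Vx /=.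
  have : p [set n | forall i, (lev i <= s)%N ->
      (posnat_int @` C) (lin G i x + posnat_int n)].
    apply: filter_forall => i.
    have [is_|] := boolP (lev i <= s)%N; last by move=> _; exact: filterE.
    have [n pn <-] := Vx _ is_; apply: filterS pn => n' Cn' _.
    by exists (n + n') => //; rewrite posnat_intD.
  move=> /G'V; apply: filterS => z Vz; apply: VU => i is_ /=.
  by rewrite linD; have [n Cn <-] := Vz _ is_; exact: Cn.
exists e'; split=> // i C is_ pC; apply: filterS (G'e' _ (G'V _ pC)) => x.
exact.
Qed.

(** * Finite image partition regular matrices *)

(** If each [t] failed somewhere, none would be left at the largest failure. This extracts one
    pattern valid at every precision [n]. *)
Lemma antitone_pigeonhole (T : finType) (P : T -> nat -> Prop) :
  (forall t n, P t n.+1 -> P t n) -> (forall n, exists t, P t n) ->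
  exists t, forall n, P t n.
Proof.
move=> Panti Pex; apply: contrapT => /forallNP nP.
have {}nP t : exists n, ~ P t n by apply/existsNP/nP.
have [bad badP] := choice nP.
have [t Pt] := Pex (\max_t bad t); apply: (badP t).
have : (bad t <= \max_t bad t)%N by exact: leq_bigmax.
move/subnK => E; move: Pt; rewrite -E.
elim: (_ - _)%N => [//|d IHd]; rewrite addSn => /Panti; exact: IHd.
Qed.

Lemma archimedean_le0 (t K : rat) : (forall N : nat, t * N%:R <= K) -> t <= 0.
Proof.
move=> tK; have K0 : 0 <= K by have := tK 0%N; rewrite mulr0.
rewrite leNgt; apply/negP => t0.
have := archi_boundP (divr_ge0 K0 (ltW t0)).
by rewrite ltr_pdivrMr// mulrC ltNge tK.
Qed.

Lemma mulmx_bound (m k : nat) (d : 'rV[rat]_m) (L : 'M[rat]_(m, k)) (N : nat)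
    (j : 'I_k) :
  (forall i, `|d 0 i| * N%:R <= 1) ->
  `|(d *m L) 0 j| * N%:R <= \sum_i `|L i j|.
Proof.
move=> dN; rewrite mxE; apply: (@le_trans _ _ (\sum_i `|d 0 i * L i j| * N%:R)).
  by rewrite -mulr_suml ler_wpM2r// ler_norm_sum.
apply: ler_sum => i _; rewrite normrM mulrAC -[leRHS]mul1r.
by rewrite ler_wpM2r.
Qed.

(** Approximation of [b] to within [1 / N] by the cone over the rows of [G] indexed by [S], without
    division so that [N = 0] is harmless. *)
Definition cone_close (k m : nat) (G : 'M[rat]_(k, m)) (b : 'rV[rat]_m)
    (S : {set 'I_k}) (N : nat) : Prop :=
  exists x : 'rV[rat]_k, [/\ forall j, 0 <= x 0 j,
    forall j, j \notin S -> x 0 j = 0 &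
    forall i, `|(x *m G - b) 0 i| * N%:R <= 1].

(** Finitely generated rational cones are closed. As in Caratheodory's theorem, a dependence among
    the rows in [S] allows one to be dropped; for independent rows the coefficients depend linearly
    on the point, and the limit can be taken. *)
Lemma cone_closed (k m : nat) (G : 'M[rat]_(k, m)) (b : 'rV[rat]_m)
    (S : {set 'I_k}) :
  (forall N, cone_close G b S N) ->
  exists x : 'rV[rat]_k, (forall j, 0 <= x 0 j) /\ x *m G = b.
Proof.
have [n] := ubnP #|S|; elim: n S => // n IHn S /ltnSE leSn close.
pose D : 'M[rat]_k := diag_mx (\row_j (j \notin S)%:R).
have DE (x : 'rV[rat]_k) : x *m D = 0 <-> forall j, j \notin S -> x 0 j = 0.
  split=> [xD j jS|xS]; last first.
    apply/rowP => j; rewrite mul_mx_diag !mxE.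
    by have [|jS] := boolP (j \in S); rewrite ?mulr0// xS ?mul0r.
  by have /rowP/(_ j) := xD; rewrite mul_mx_diag !mxE jS mulr1.
have [[v [v0 vS vG]]|indep] := pselect (exists v : 'rV[rat]_k,
    [/\ v != 0, forall j, j \notin S -> v 0 j = 0 & v *m G = 0]).
  wlog [j0 vj0] : v v0 vS vG / exists j, 0 < v 0 j.
    move=> wl; have [j vj] : exists j, v 0 j != 0 by apply/rV0Pn.
    have [vj_gt0|vj_le0] := ltP 0 (v 0 j).
      by apply: (wl v) => //; exists j.
    apply: (wl (- v)); rewrite ?oppr_eq0 ?mulNmx ?vG ?oppr0//.
      by move=> i iS; rewrite mxE vS ?oppr0.
    by exists j; rewrite mxE oppr_gt0 lt_neqAle vj.
  have [j|N|j jP] := @antitone_pigeonhole _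
    (fun j N => j \in S /\ cone_close G b (S :\ j)%SET N).
  - move=> N [jS [x [x0 xS xG]]]; split=> //; exists x; split=> // i.
    by apply: le_trans (xG i); rewrite ler_wpM2l// ler_nat.
  - have [x [x0 xS xG]] := close N.
    (* The smallest ratio is the largest multiple of [v] that can be subtracted from [x] within the
       cone, and it cancels a coordinate. That coordinate may depend on [N], whence the
       pigeonhole. *)
    pose i0 := [arg min_(j < j0 | 0 < v 0 j) (x 0 j / v 0 j)]%O.
    have [i vi imin] : extremum_spec <=%O (fun j => 0 < v 0 j)
        (fun j => x 0 j / v 0 j) i0 by rewrite /i0; case: arg_minP.
    have t0 : 0 <= x 0 i / v 0 i by rewrite divr_ge0// ltW.
    exists i; split.
      by apply: contraTT vi => iS; rewrite vS ?ltxx.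
    exists (x - (x 0 i / v 0 i) *: v); split=> [j|j|j].
    + rewrite !mxE subr_ge0; have [vj|vj] := ltP 0 (v 0 j).
        by rewrite -ler_pdivlMr// imin.
      by apply: le_trans (x0 j); rewrite mulr_ge0_le0.
    + rewrite !inE negb_and negbK => /orP[/eqP->|jS].
        by rewrite !mxE divfK ?subrr// gt_eqF.
      by rewrite !mxE (xS j)// (vS j)// mulr0 subrr.
    + by rewrite mulmxBl -scalemxAl vG scaler0 subr0.
  have [jS _] := jP 0%N.
  apply: (IHn (S :\ j)%SET) => [|N]; last by have [] := jP N.
  by rewrite (cardsD1 j) jS in leSn.
pose M := row_mx G D.
have Mfree : row_free M.
  apply: inj_row_free => v; rewrite mul_mx_row => /eqP.
  rewrite row_mx_eq0 => /andP[/eqP vG /eqP/DE vS].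
  by apply: contrapT => /eqP v0; apply: indep; exists v.
pose L := usubmx (pinvmx M).
have GL (x : 'rV[rat]_k) :
    (forall j, j \notin S -> x 0 j = 0) -> x *m G *m L = x.
  move=> /DE xD; rewrite -[RHS]mulmx1 -(mulmxVp Mfree) mulmxA mul_mx_row xD.
  by rewrite -[pinvmx M]vsubmxK mul_row_col mul0mx addr0.
exists (b *m L); split=> [j|].
  rewrite -oppr_le0; apply: (@archimedean_le0 _ (\sum_i `|L i j|)) => N.
  have [x [x0 xS xG]] := close N.
  apply: le_trans (mulmx_bound L j xG); rewrite ler_wpM2r//.
  rewrite mulmxBl GL//; apply: le_trans (ler_norm _).
  have -> : (x - b *m L) 0 j = x 0 j - (b *m L) 0 j by rewrite !mxE.
  by rewrite lerDr.
apply/rowP => i; apply/eqP; rewrite -subr_eq0 -normr_le0.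
apply: (@archimedean_le0 _ (1 + \sum_l `|(L *m G) l i|)) => N.
have [x [x0 xS xG]] := close N; pose d := x *m G - b.
have -> : (b *m L *m G) 0 i - b 0 i = d 0 i - (d *m (L *m G)) 0 i.
  have -> : d *m (L *m G) = x *m G - b *m L *m G.
    by rewrite !mulmxA mulmxBl GL// mulmxBl.
  move: (b *m L *m G) (x *m G) @d => u w /=; rewrite !mxE; ring.
apply: (@le_trans _ _ ((`|d 0 i| + `|(d *m (L *m G)) 0 i|) * N%:R)).
  by rewrite ler_wpM2r// ler_normB.
by rewrite mulrDl lerD ?mulmx_bound.
Qed.

(** The colour records the parity of [lvl n] and the two leading digits of [n * b] in base
    [b = N + 2]. Equal digits on one level force closeness; equal parities keep distinct levels two
    apart. Subtraction is truncated, so exchanging [n] and [n'] gives the other bound. *)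
Lemma exists_log_coloring (N : nat) :
  exists (K : finType) (col : posnat -> K) (lvl : posnat -> nat),
    forall n n' : posnat, col n = col n' ->
      (lvl n = lvl n' -> ((n - n') * N <= n')%N) /\
      ((lvl n < lvl n')%N -> (n * N <= n')%N).
Proof.
pose b := N.+2; pose lvl (n : posnat) := trunc_log b n.
have lo (n : posnat) : (b ^ lvl n <= n)%N.
  by case: n => n n0; have /andP[] := trunc_log_bounds (isT : 1 < b)%N n0.
have hi (n : posnat) : (n < b ^ (lvl n).+1)%N.
  by case: n => n n0; have /andP[] := trunc_log_bounds (isT : 1 < b)%N n0.
have b_gt0 l : (0 < b ^ l)%N by rewrite expn_gt0.
have mant_lt (n : posnat) : (n * b %/ b ^ lvl n < b * b)%N.
  by rewrite ltn_divLR// -mulnA -expnS mulnC ltn_mul2l hi.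
exists (bool * 'I_(b * b))%type.
exists (fun n => (odd (lvl n), Ordinal (mant_lt n))), lvl => n n' [oddE mantE].
split=> lvlE; last first.
  have lt2 : ((lvl n).+2 <= lvl n')%N.
    rewrite ltn_neqAle lvlE andbT.
    by apply: contra_eq_neq oddE => <- /=; case: odd.
  apply: leq_trans (lo n'); apply: leq_trans (leq_pexp2l _ lt2) => //.
  by rewrite expnS mulnC leq_mul// ?(ltnW (hi n))// leqW.
rewrite -lvlE in mantE; apply: leq_trans (lo n'); rewrite -lvlE.
apply: (@leq_trans ((n - n') * b)); first by rewrite leq_mul2l !leqW ?orbT.
rewrite mulnBl (divn_eq (n * b) (b ^ lvl n)) (divn_eq (n' * b) (b ^ lvl n)).
rewrite mantE subnDl; apply: leq_trans (leq_subr _ _) _.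
by rewrite ltnW// ltn_pmod.
Qed.

Lemma mx_apply_ord (I : Type) (k : nat) (F : I -> 'I_k -> rat)
    (x : 'I_k -> posnat) i :
  mx_apply F x i = \sum_j F i j * (x j)%:R.
Proof.
rewrite /mx_apply (@fsbigE _ _ _ _ _ (index_enum 'I_k)) ?index_enum_uniq//.
  by apply: eq_bigl => j; rewrite in_setT.
by move=> j _; rewrite mem_index_enum.
Qed.

Lemma ipr_coloring (I : Type) (J : choiceType) (M : I -> J -> rat) (K : finType)
    (col : posnat -> K) :
  image_partition_regular M ->
  exists (c : K) (x : J -> posnat), image_in M x [set n | col n = c].
Proof.
move=> [_ /(_ #|K| (fun i => [set n | col n = enum_val i]))].
case=> [|i [x xM]]; last by exists (enum_val i), x.
apply/seteqP; split=> // n _; exists (enum_rank (col n)) => //=.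
by rewrite enum_rankK.
Qed.

(* The analogue, for image partition regularity, of Rado's columns condition:
   the rows split into levels, and colouring by leading digits yields images in
   which each level dominates the lower ones. *)
Lemma ipr_levels (m k : nat) (F : 'I_m -> 'I_k -> rat) :
  image_partition_regular F ->
  exists lev : 'I_m -> nat, forall i0, exists y : 'I_k -> rat,
    (forall j, 0 <= y j) /\
    forall i, (lev i <= lev i0)%N ->
      \sum_j F i j * y j = (lev i == lev i0)%:R.
Proof.
move=> Fipr.
pose P (lev : {ffun 'I_m -> 'I_m.+1}) (N : nat) :=
  exists (x : 'I_k -> posnat) (n : 'I_m -> posnat),
    (forall i, \sum_j F i j * (x j)%:R = (n i)%:R) /\
    forall i i', (lev i = lev i' -> ((n i - n i') * N <= n i')%N) /\
      ((lev i < lev i')%N -> (n i * N <= n i')%N).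
have [lev N|N|lev levP] := @antitone_pigeonhole _ P.
- move=> [x [n [xn levn]]]; exists x, n; split=> // i i'.
  have [lev_eq lev_lt] := levn i i'; split=> H.
    by apply: leq_trans (lev_eq H); rewrite leq_mul2l leqnSn orbT.
  by apply: leq_trans (lev_lt H); rewrite leq_mul2l leqnSn orbT.
- have [K [col [lvl colP]]] := exists_log_coloring N.
  have [c [x xc]] := ipr_coloring col Fipr.
  have /choice[n nP] : forall i, exists n : posnat,
      col n = c /\ \sum_j F i j * (x j)%:R = (n : nat)%:R.
    by move=> i; have [n nc nE] := xc i; exists n; rewrite -mx_apply_ord nE.
  (* Logarithmic levels are unbounded as [N] varies; ranks keep only their order, leaving finitely
     many candidates for [lev]. *)
  pose rk i := #|[pred j | (lvl (n j) < lvl (n i))%N]|.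
  have rk_lt i : (rk i < m.+1)%N by rewrite ltnS -[leqRHS]card_ord max_card.
  have rkS i i' : (lvl (n i) < lvl (n i'))%N -> (rk i < rk i')%N.
    move=> lt_ii'; apply/proper_card/properP; split.
      by apply/fintype.subsetP => j; rewrite !inE => /ltn_trans; apply.
    by exists i; rewrite !inE ?lt_ii' ?ltnn.
  exists [ffun i => Ordinal (rk_lt i)]; exists x, n.
  split=> [i|i i']; first by have [] := nP i.
  have [ni _] := nP i; have [ni' _] := nP i'.
  have [col_eq col_lt] := colP (n i) (n i') (etrans ni (esym ni')).
  rewrite !ffunE; split=> [[rkE]|/= rk_ltE].
    apply: col_eq; apply/eqP; rewrite eqn_leq.
    by apply/andP; split; rewrite leqNgt; apply/negP => /rkS; rewrite rkE ltnn.
  apply: col_lt; rewrite ltnNge leq_eqVlt; apply/negP => /orP[/eqP lvlE|/rkS].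
    by move: rk_ltE; rewrite /rk lvlE ltnn.
  by rewrite ltnNge ltnW.
exists (fun i => lev i : nat) => i0 /=.
(* Rows above [lev i0] are unconstrained and are zeroed. Dividing [x] by [n i0] then approximates
   [b], and closedness of the cone makes this exact. *)
pose G := \matrix_(j, i) if (lev i <= lev i0)%N then F i j else 0.
pose b : 'rV[rat]_m := \row_i ((lev i : nat) == lev i0)%:R.
have [N|y [y0 yG]] := @cone_closed _ _ G b [set: 'I_k]%SET.
  have [x [n [xn levn]]] := levP N.
  have n_gt0 : 0 < (n i0)%:R :> rat by rewrite ltr0n; case: (n i0).
  exists (\row_j ((x j)%:R / (n i0)%:R)); split=> [j|j|i].
  - by rewrite mxE divr_ge0.
  - by rewrite inE.
  have -> : ((\row_j ((x j)%:R / (n i0)%:R)) *m G - b) 0 i =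
      (if (lev i <= lev i0)%N then (n i)%:R / (n i0)%:R else 0)
        - ((lev i : nat) == lev i0)%:R.
    rewrite !mxE; congr (_ - _); case: ifP => [le_i|gt_i].
      rewrite -(xn i) mulr_suml; apply: eq_bigr => j _.
      by rewrite !mxE le_i mulrC mulrA.
    by rewrite big1// => j _; rewrite !mxE gt_i mulr0.
  have [eqi eqi0] := (levn i i0, levn i0 i).
  case: ltngtP => [lt_i|gt_i|eq_i].
  - rewrite subr0 ger0_norm ?divr_ge0// mulrAC ler_pdivrMr// mul1r.
    by rewrite -natrM ler_nat; apply: (proj2 eqi).
  - by rewrite subr0 normr0 mul0r.
  have lE : lev i = lev i0 by apply: val_inj.
  have -> : (n i)%:R / (n i0)%:R - 1 = ((n i)%:R - (n i0)%:R) / (n i0)%:R :> rat.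
    by rewrite mulrBl divff// gt_eqF.
  rewrite normrM normfV [X in _ / X]ger0_norm// mulrAC ler_pdivrMr// mul1r.
  have := proj1 eqi lE; have := proj1 eqi0 (esym lE).
  move: (posnat_val (n i)) (posnat_val (n i0)) => u w wu uw.
  have [le_uw|/ltnW le_wu] := leqP u w.
    rewrite distrC -natrB// normr_nat -natrM ler_nat; exact: leq_trans wu _.
  by rewrite -natrB// normr_nat -natrM ler_nat.
exists (fun j => y 0 j); split=> // i le_i.
have /rowP/(_ i) := yG; rewrite !mxE => <-.
by apply: eq_bigr => j _; rewrite mxE le_i mulrC.
Qed.

Lemma common_denominator (I : finType) (f : I -> rat) :
  exists2 d : nat, (0 < d)%N & forall i, exists z : int, f i * d%:R = z%:~R.
Proof.
exists (\prod_i `|denq (f i)|)%N.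
  by rewrite prodn_gt0// => i; rewrite absz_gt0 denq_eq0.
move=> i; rewrite (bigD1 i)//=.
set r := (\prod_(_ | _) _)%N; exists (numq (f i) * r%:Z).
rewrite natrM mulrA rmorphM /=; congr (_ * _).
by rewrite -[X in X * _]divq_num_den pmulrn absz_denq divfK ?intr_eq0.
Qed.

Lemma posnat_mul_gt0 (d : nat) (n : posnat) : (0 < d)%N -> (0 < d * n)%N.
Proof. by case: n => n n_gt0 d_gt0; rewrite muln_gt0 d_gt0. Qed.

(** Clearing denominators: [G] is [d] times [M], so [lin G i x] is an entry of [M] applied to [d x].
    Scaling the rational [y] by [e] turns the level constant into [d * e]. *)
Lemma central_ipr_image (F p : set_system posnat) (m k : nat)
    (M : 'I_m -> 'I_k -> rat) (C : set posnat) :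
    maximal_invariant F -> finer F p -> beta_add p p = p -> p C ->
    image_partition_regular M ->
  exists x : 'I_k -> posnat, image_in M x C.
Proof.
move=> Fmax Lp pp pC Mipr.
have [lev levP] := ipr_levels Mipr.
have [d d_gt0 /choice[G0 GE]] :=
  common_denominator (fun ij : 'I_m * 'I_k => M ij.1 ij.2).
pose G i j := G0 (i, j).
have /choice[y yP] := levP.
have [e e_gt0 /choice[z0 zE]] :=
  common_denominator (fun ij : 'I_m * 'I_k => y ij.1 ij.2).
have [||eps [epsU _ epsC]] := @central_image_idempotent F p m k G lev (d * e)
  Fmax Lp pp.
- by rewrite muln_gt0 d_gt0.
- move=> i0; exists (fun j => `|z0 (i0, j)|%N) => i; have [y0 yM] := yP i0.
  have z0_ge0 j : 0 <= z0 (i0, j).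
    by rewrite -(ler0z rat) -zE mulr_ge0.
  have sumE : (\sum_j G i j * (`|z0 (i0, j)|%N)%:Z)%:~R =
      (\sum_j M i j * y i0 j) * (d * e)%N%:R :> rat.
    rewrite rmorph_sum mulr_suml; apply: eq_bigr => j _ /=.
    rewrite gez0_abs// rmorphM /= -zE -(GE (i, j)) natrM /=; ring.
  split=> levE; apply: (@intr_inj rat); rewrite sumE.
    by rewrite yM levE// eqxx mul1r.
  by rewrite yM ?ltn_eqF ?mul0r// ltnW.
have /filter_ex[x xC] : eps [set x | forall i, (posnat_int @` C) (lin G i x)].
  by apply: filter_forall => i; exact: epsC.
exists (fun j => PosNat (posnat_mul_gt0 (x j) d_gt0)) => i.
have [n Cn nE] := xC i; exists n => //.
rewrite mx_apply_ord /= -[LHS]/((posnat_int n)%:~R) nE rmorph_sum /=.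
apply: eq_bigr => j _.
by rewrite rmorphM /= -(GE (i, j)) natrM mulrA.
Qed.

(** * Sums of dilates of an idempotent *)

Lemma posnat_gt0 (n : posnat) : (0 < n)%N.
Proof. by case: n. Qed.

(* [mt_filter p [:: a1; ...; ak]] is [a1 p + ... + ak p], as an ultrafilter
   on [nat]. *)
Fixpoint mt_filter (p : set_system posnat) (a : seq nat) : set_system nat :=
  if a is u :: a' then
    [set E | p [set n : posnat | mt_filter p a' [set m | E (u * n + m)%N]]]
  else [set E | E 0%N].

#[local] Instance mt_filter_filter (p : set_system posnat) (a : seq nat) :
  Filter p -> Filter (mt_filter p a).
Proof.
move=> pF; elim: a => [|u a IHa] /=; first by split=> // U V UV; exact: UV.
split.
- by apply: (@filterE _ p) => n; apply: (@filterE _ (mt_filter p a)).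
- move=> U V /= pU pV; apply: filterS2 pU pV => n /=.
  exact: (@filterI _ (mt_filter p a)).
- move=> U V UV /=; apply: filterS => n /=.
  by apply: (@filterS _ (mt_filter p a)) => m; exact: UV.
Qed.

Lemma mt_filter_exists_seq (I : eqType) (p : set_system posnat) (a : seq nat)
    (s : seq I) (P : I -> set nat) : UltraFilter p ->
  mt_filter p a [set m | exists2 i, i \in s & P i m] ->
  exists2 i, i \in s & mt_filter p a (P i).
Proof.
move=> pU; elim: a P => [|u a IHa] P //= paP.
apply: (ultra_exists_seq pU); apply: filterS paP => n /=.
exact: (IHa (fun i => [set m | P i (u * n + m)%N])).
Qed.

Lemma mt_filter_gt0 (p : set_system posnat) (a : seq nat) : Filter p ->
  (0 < size a)%N -> 0%N \notin a -> mt_filter p a [set m | (0 < m)%N].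
Proof.
move=> pF; case: a => //= u a _; rewrite inE negb_or => /andP[u0 _].
apply: filterE => n; apply: filterE => m /=.
by rewrite addn_gt0 muln_gt0 posnat_gt0 lt0n eq_sym u0.
Qed.

Definition posnat_scale (u : nat) (u_gt0 : (0 < u)%N) (n : posnat) : posnat :=
  PosNat (posnat_mul_gt0 n u_gt0).

Lemma mx_apply_scale (I : Type) (J : choiceType) (M : I -> J -> rat)
    (x : J -> posnat) (u : nat) (u_gt0 : (0 < u)%N) i :
  mx_apply M (fun j => posnat_scale u_gt0 (x j)) i = u%:R * mx_apply M x i.
Proof.
rewrite /mx_apply mulr_fsumr; apply: eq_fsbigr => j _ /=.
by rewrite natrM mulrCA.
Qed.

Lemma finer_central (F p : set_system posnat) (C : set posnat) :
  maximal_invariant F -> finer F p -> beta_add p p = p -> p C -> central C.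
Proof.
move=> Fmax Lp pp pC; exists p; split=> //; first by case: Lp.
exact: finer_beta_K Lp.
Qed.

Lemma image_in_choice (I : Type) (J : choiceType) (M : I -> J -> rat)
    (x : J -> posnat) (C : set posnat) : image_in M x C ->
  exists c : I -> posnat, forall i, C (c i) /\ (c i)%:R = mx_apply M x i.
Proof.
move=> xM; suff /choice[c cP] : forall i, exists n : posnat,
    C n /\ (n : nat)%:R = mx_apply M x i by exists c.
by move=> i; have [n Cn nE] := xM i; exists n.
Qed.

(** Each summand contributes a vector for [M], whereas [D] uses only the last. [M] is served first
    since its finitely many rows allow the remaining conditions to be intersected. *)
Lemma mt_filter_block_image (F p : set_system posnat) (m k : nat)
    (M : 'I_m -> 'I_k -> rat) (D : nat -> nat -> rat) (a : seq nat)
    (E : set nat) :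
    maximal_invariant F -> finer F p -> beta_add p p = p ->
    image_partition_regular M -> centrally_image_partition_regular D ->
    (0 < size a)%N -> 0%N \notin a -> mt_filter p a E ->
  exists (x : 'I_k -> posnat) (y : nat -> posnat), forall i r,
    exists2 n, E n & n%:R = mx_apply M x i + mx_apply D y r.
Proof.
move=> Fmax Lp pp Mipr Dipr; have [pU _] := Lp.
elim: a E => // u a IHa E _; rewrite inE negb_or => /andP[u0 a0].
have u_gt0 : (0 < u)%N by rewrite lt0n eq_sym.
(* A single summand is split by [p = p + p], one half for [M] and one for [D]. The [+ 0] below is
   the empty sum. *)
have [->|aN] := eqVneq a [::] => /= paE.
  have := paE; rewrite -{1}pp => paE2.
  have [x /image_in_choice[c cP]] := central_ipr_image Fmax Lp pp paE2 Mipr.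
  have pW : p [set m : posnat | forall i, E (u * (c i + m)%R + 0)%N].
    by apply: filter_forall => i; have [pc _] := cP i; exact: pc.
  have [y yD] := Dipr _ (finer_central Fmax Lp pp pW).
  exists (fun j => posnat_scale u_gt0 (x j)).
  exists (fun j => posnat_scale u_gt0 (y j)).
  move=> i r; have [w Ew wE] := yD r; exists (u * (c i + w)%R + 0)%N => //.
  have [_ cE] := cP i.
  by rewrite !mx_apply_scale -wE -cE addn0 natrM natrD mulrDr.
have [x /image_in_choice[c cP]] := central_ipr_image Fmax Lp pp paE Mipr.
have paW : mt_filter p a [set m | forall i, E (u * c i + m)%N].
  by apply: filter_forall => i; have [pc _] := cP i; exact: pc.
have [|x' [y x'y]] := IHa _ _ a0 paW; first by rewrite lt0n size_eq0.
exists (fun j => posnat_scale u_gt0 (x j) + x' j), y => i r.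
have [w Ew wE] := x'y i r; exists (u * c i + w)%N; first exact: Ew.
have [_ cE] := cP i.
rewrite natrD natrM wE cE addrA; congr (_ + _).
rewrite !mx_apply_ord mulr_sumr -big_split; apply: eq_bigr => j _ /=.
by rewrite natrD mulrDr natrM mulrCA.
Qed.

(** * Milliken-Taylor systems *)

Lemma last_mask_pairmap (u : nat) (t : seq nat) :
  last u (mask (pairmap (fun v w => w != v) u t) t) = last u t.
Proof.
elim: t u => //= w t IHt u; case: eqVneq => [->|_] /=; exact: IHt.
Qed.

Lemma compress_rcons (s : seq nat) (v : nat) :
  compress (rcons s v) =
  if v == 0%N then compress s else
  if compress s is u :: t then
    if v == last u t then compress s else rcons (compress s) v
  else [:: v].
Proof.
rewrite /compress /delete0 filter_rcons; have [//|v0] /= := eqVneq v 0%N.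
case: [seq _ <- _ | _] => //= u t; rewrite last_mask_pairmap.
rewrite -!cats1 pairmap_cat mask_cat ?size_pairmap//=.
by case: eqP; rewrite ?cats0.
Qed.

Lemma compress_neq0 (s : seq nat) : 0%N \notin compress s.
Proof.
rewrite /compress; have : 0%N \notin delete0 s by rewrite mem_filter.
case: (delete0 s) => //= u t; rewrite !inE !negb_or => /andP[-> t0] /=.
by apply: contra t0; exact: mem_mask.
Qed.

(* Obligations [(b, v)] record that a partial sum [v] of a row is to be
   completed by a sum of type [b]. *)
Definition obligation_step (x : posnat) (o : seq nat * nat) :
    seq (seq nat * nat) :=
  if o.1 is u :: b then
    [:: (u :: b, o.2 + u * x)%N; (b, o.2 + u * x)%N]
  else [::].

(** The history [h] is listed latest first. A zero coefficient keeps an obligation; a coefficient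
    [u] leaves its block either open to further [u] or closed. *)
Fixpoint obligations (a : seq nat) (h : seq posnat) : seq (seq nat * nat) :=
  if h is x :: h' then
    obligations a h' ++
    flatten [seq obligation_step x o | o <- obligations a h']
  else [:: (a, 0%N)].

Definition fulfillable (p : set_system posnat) (E : set nat)
    (o : seq nat * nat) : Prop :=
  mt_filter p o.1 [set m | E (o.2 + m)%N].

(** Closing a block is the definition of [mt_filter]; keeping it open uses [p = p + p]. Finitely
    many obligations impose finitely many members of [p]. *)
Lemma fulfillable_next (p : set_system posnat) (E : set nat) (a : seq nat)
    (h : seq posnat) : UltraFilter p -> beta_add p p = p ->
  (forall o, o \in obligations a h -> fulfillable p E o) ->
  exists x, forall o, o \in obligations a (x :: h) -> fulfillable p E o.
Proof.
move=> pU pp hE.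
have : p [set x | forall o, o \in obligations a h ->
    forall o', o' \in obligation_step x o -> fulfillable p E o'].
  apply: filter_forall_seq => -[[|u b] v] oh; first exact: filterE.
  have := hE _ oh; rewrite /fulfillable /= => pE.
  have := pE; rewrite -{1}pp => pE2.
  apply: filterS2 pE pE2 => x /= xE xE2 o'; rewrite !inE => /orP[]/eqP-> /=.
    apply: filterS xE2 => y; apply: filterS => w /=.
    by rewrite mulnDr !addnA.
  by apply: filterS xE => w /=; rewrite addnA.
move=> /filter_ex[x xE]; exists x => o /=; rewrite mem_cat => /orP[/hE//|].
by move=> /flatten_mapP[o' o'h]; exact: xE.
Qed.

(** The second clause strengthens the induction: the next nonzero entry either repeats the last one
    [u], whose block must then be open, or is the head of [rest]. *)
Lemma obligation_row (a : seq nat) (x : nat -> posnat) (r : nat -> nat)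
    (h : nat -> seq posnat) :
    h 0%N = [::] -> (forall n, h n.+1 = x n :: h n) ->
  forall n rest, a = compress (mkseq r n) ++ rest ->
    (rest, \sum_(j < n) r j * x j)%N \in obligations a (h n) /\
    forall q u, compress (mkseq r n) = rcons q u ->
      (u :: rest, \sum_(j < n) r j * x j)%N \in obligations a (h n).
Proof.
move=> h0 hS; elim=> [|n IHn] rest.
  move=> /= <-; rewrite big_ord0 h0 mem_head; split=> // q u.
  by move=> /(congr1 size); rewrite size_rcons.
rewrite mkseqS compress_rcons big_ord_recr /= hS /=.
set s := (\sum_(j < n) _)%N.
have keep o : o \in obligations a (h n) -> o \in obligations a (x n :: h n).
  by move=> oh; rewrite /= mem_cat oh.
have step u b : (u :: b, s) \in obligations a (h n) ->
    (u :: b, s + u * x n)%N \in obligations a (x n :: h n) /\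
    (b, s + u * x n)%N \in obligations a (x n :: h n).
  move=> oh; rewrite /= !mem_cat; split; apply/orP; right; apply/flatten_mapP;
    by exists (u :: b, s); rewrite ?inE ?eqxx ?orbT.
have [->|r0] := eqVneq (r n) 0%N.
  move=> /IHn [H1 H2]; rewrite mul0n addn0.
  by split=> [|q u /H2]; exact: keep.
case cE : (compress (mkseq r n)) => [|u t]; rewrite cE in IHn.
  move=> /= aE; have [H1 _] := IHn (r n :: rest) aE.
  have [H3 H4] := step _ _ H1; split=> // q v.
  by case: q => [[<-]//|? []].
case: eqVneq => [->|rN] aE.
  have [_ H2] := IHn _ aE; have := H2 _ _ (lastI u t).
  by move=> /step[H3 H4]; split=> // q v; rewrite lastI => /rcons_inj[_ <-].
rewrite cat_rcons in aE; have [H1 _] := IHn _ aE.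
by have [H3 H4] := step _ _ H1; split=> // q v /rcons_inj[_ <-].
Qed.

Lemma milliken_taylor_sequence (p : set_system posnat) (a : seq nat)
    (E : set nat) : UltraFilter p -> beta_add p p = p -> mt_filter p a E ->
  exists x : nat -> posnat, forall (r : nat -> nat) (N : nat),
    compress (mkseq r N) = a -> E (\sum_(j < N) r j * x j)%N.
Proof.
move=> pU pp paE.
pose good h := forall o, o \in obligations a h -> fulfillable p E o.
(* Histories that are not good receive the default value [1]. *)
have /choice[next nextP] : forall h, exists x, good h -> good (x :: h).
  move=> h; have [gh|] := pselect (good h); last by exists (@PosNat 1 isT).
  by have [x xh] := fulfillable_next pU pp gh; exists x.
pose h n := iter n (fun h => next h :: h) [::].
have goodh n : good (h n).
  elim: n => [o|n]; last exact: nextP.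
  by rewrite inE => /eqP->.
exists (fun n => next (h n)) => r N aE.
have [] := @obligation_row a (fun n => next (h n)) r h erefl (fun=> erefl) N
  [::].
  by rewrite aE cats0.
by move=> /goodh; rewrite /fulfillable /= addn0.
Qed.

(** * Block matrices and the final assembly *)

Lemma mx_apply_bounded (I : Type) (M : I -> nat -> rat) (x : nat -> posnat) i
    (N : nat) :
  (forall j, (N <= j)%N -> M i j = 0) ->
  mx_apply M x i = \sum_(j < N) M i j * (x j)%:R.
Proof.
move=> M0; rewrite [RHS](fsbig_ord _ N (fun j => M i j * (x j)%:R)).
apply/esym/fsbig_widen => // j [_ /negP].
by rewrite -leqNgt => /M0/= ->; rewrite mul0r.
Qed.

Lemma row_finite_bound (I : Type) (R : nmodType) (M : I -> nat -> R) i :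
  row_finite M -> exists N, forall j, (N <= j)%N -> M i j = 0.
Proof.
move=> /(_ i)/finite_seqP[s sE]; exists (\max_(j <- s) j).+1 => j jN.
apply/eqP; apply: contraTT jN => Mj; rewrite -ltnNge ltnS.
have js : j \in s by have : [set` s] j by rewrite -sE.
by apply: leq_bigmax_seq.
Qed.

Lemma mx_apply_block_diagl (I1 I2 : Type) (J1 J2 : choiceType)
    (A : I1 -> J1 -> rat) (B : I2 -> J2 -> rat) (z : J1 + J2 -> posnat) i :
  mx_apply (block_diag A B) z (inl i) = mx_apply A (z \o inl) i.
Proof.
transitivity (\sum_(j \in inl @` [set: J1]) block_diag A B (inl i) j * (z j)%:R);
  last by rewrite fsbig_image// => j j' _ _ [].
apply/esym/fsbig_widen => // -[j [_ []]|j _ /=]; first by exists j.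
by rewrite mul0r.
Qed.

Lemma mx_apply_block_diagr (I1 I2 : Type) (J1 J2 : choiceType)
    (A : I1 -> J1 -> rat) (B : I2 -> J2 -> rat) (z : J1 + J2 -> posnat) i :
  mx_apply (block_diag A B) z (inr i) = mx_apply B (z \o inr) i.
Proof.
transitivity (\sum_(j \in inr @` [set: J2]) block_diag A B (inr i) j * (z j)%:R);
  last by rewrite fsbig_image// => j j' _ _ [].
apply/esym/fsbig_widen => // -[j _ /=|j [_ []]]; last by exists j.
by rewrite mul0r.
Qed.

Lemma row_finite_block_diag (I1 I2 J1 J2 : Type)
    (A : I1 -> J1 -> rat) (B : I2 -> J2 -> rat) :
  row_finite A -> row_finite B -> row_finite (block_diag A B).
Proof.
move=> Afin Bfin [i|i].
  apply: sub_finite_set (finite_image inl (Afin i)) => -[j|j] /=; rewrite ?eqxx//.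
  by move=> Aj; exists j.
apply: sub_finite_set (finite_image inr (Bfin i)) => -[j|j] /=; rewrite ?eqxx//.
by move=> Bj; exists j.
Qed.

Definition insert_columns (n k : nat) (x : 'I_k -> posnat) (y : nat -> posnat)
    (j : nat) : posnat :=
  if (j < n)%N then y j else
  if insub (j - n)%N is Some l then x l else y (j - k)%N.

Lemma mx_apply_insert_columns (A : nat -> nat -> rat) (n k : nat)
    (x : 'I_k -> posnat) (y : nat -> posnat) i :
  row_finite A ->
  mx_apply A (insert_columns n x y) i =
  mx_apply (columns_block A n (k := k)) x i + mx_apply (drop_columns A n k) y i.
Proof.
move=> /(row_finite_bound i)[N AN].
(* [N] bounds the support of the row; both ranges are enlarged so that they split at column [n]. *)
rewrite (@mx_apply_bounded _ A _ _ (n + (k + N))); last first.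
  by move=> j jN; apply: AN; apply: leq_trans jN; rewrite !addnA leq_addl.
rewrite (@mx_apply_bounded _ (drop_columns A n k) _ _ (n + N)); last first.
  move=> j jN; rewrite /drop_columns ltnNge (leq_trans (leq_addr _ _) jN) /=.
  apply: AN; apply: leq_trans (leq_addr _ _).
  by apply: leq_trans jN; rewrite leq_addl.
rewrite mx_apply_ord !big_split_ord /= addrCA; congr (_ + (_ + _)).
- apply: eq_bigr => j _; rewrite /insert_columns ltnNge leq_addr /=.
  rewrite addKn; case: insubP => [l _ /= lj|]; last by rewrite ltn_ord.
  by congr (_ * _%:R); congr (posnat_val (x _)); exact: val_inj.
- apply: eq_bigr => j _.
  by rewrite /drop_columns /insert_columns /= ltn_ord.
- apply: eq_bigr => j _; rewrite /drop_columns /insert_columns.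
  rewrite !(ltnNge _ n) !leq_addr /= insubF; last by rewrite addKn ltnNge leq_addr.
  by rewrite addnCA addKn [(k + (n + j))%N]addnC.
Qed.

Theorem theorem2p16 (A : nat -> nat -> rat) (B : nat -> nat -> nat)
    (hA : subtracted_centrally_image_partition_regular A)
    (hB : milliken_taylor B) :
  image_partition_regular (block_diag A (fun i j => ((B i j)%:R)%R)).
Proof.
have [_ Afin [n [k [_ [m [M [Mipr colM]]] Dipr]]]] := hA.
have [Bfin [a [a_gt0 aC Brow]]] := hB.
have BRfin : row_finite (fun i j => ((B i j)%:R : rat)).
  by move=> i; apply: sub_finite_set (Bfin i) => j /=; rewrite pnatr_eq0.
split; first exact: row_finite_block_diag.
move=> r E Ecover.
have a0 : 0%N \notin a by rewrite -aC compress_neq0.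
have [F Fmax] := maximal_invariant_exists (@PosNat 1 isT).
have [p [Lp pp]] := finer_idempotent Fmax; have [pU _] := Lp.
(* The colours cover only the positive integers, which form a member because [a] is nonempty without
   zeros. *)
have [i _ paE] : exists2 i, i \in enum 'I_r &
    mt_filter p a ((fun m : posnat => m : nat) @` E i).
  apply: mt_filter_exists_seq; apply: filterS (mt_filter_gt0 _ a_gt0 a0) => w w0.
  have : [set: posnat] (PosNat w0) by [].
  rewrite Ecover => -[i _ Ei]; exists i; first by rewrite mem_enum.
  by exists (PosNat w0).
have [x [y xy]] := mt_filter_block_image Fmax Lp pp Mipr Dipr a_gt0 a0 paE.
have [z zE] := milliken_taylor_sequence pU pp paE.
exists i, (fun j =>
  match j with inl j => insert_columns n x y j | inr j => z j end).
move=> [q|q]; rewrite (mx_apply_block_diagl, mx_apply_block_diagr) /comp.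
  (* Only the sets of rows agree, so [l] is uncontrolled; [xy] holds for every pair of a row of [M]
     and a row of the remaining columns. *)
  have [l _ ql] : range (fun i j => M i j) (columns_block A n (k := k) q).
    by rewrite -colM; exists q.
  have [_ [c Ec <-] cE] := xy l q; exists c => //.
  rewrite mx_apply_insert_columns// cE; congr (_ + _).
  by rewrite !mx_apply_ord -ql.
have : [set r | has_compression r a] (B q) by rewrite -Brow; exists q.
move=> [N BN /zE [c Ec cE]]; exists c => //.
rewrite cE (@mx_apply_bounded _ _ _ _ N) => [|j /BN ->//].
by rewrite natr_sum; apply: eq_bigr => j _; rewrite natrM.
Qed.
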